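(* Let $a=\{a_n\}_{n\ge1}$ be a positive, non-increasing, summable sequence with $\sum_{n\ge1}a_n=1$, let $E\in\mathcal{C}_a$ be any complementary set of $a$, and let $\theta\in[0,1]$. Then $$\overline{\dim}_\theta D_a\le\overline{\dim}_\theta E\qquad\text{and}\qquad \underline{\dim}_\theta D_a\le\underline{\dim}_\theta E.$$
   Context: Intermediate dimensions. Write $|U|$ for the diameter of $U\subset\mathbb{R}$. For bounded $F\subseteq\mathbb{R}$ and $\theta\in[0,1]$, the lower $\theta$-intermediate dimension $\underline{\dim}_\theta F$ is the infimum of all $s\ge 0$ such that for every $\epsilon>0$ and every $\delta_0>0$ there exist $0<\delta\le\delta_0$ and a cover $\{U_i\}_{i\in I}$ of $F$ with $\delta^{1/\theta}\le |U_i|\le \delta$ for all $i$ and $\sum_{i}|U_i|^s\le\epsilon$. The upper $\theta$-intermediate dimension $\overline{\dim}_\theta F$ is the infimum of all $s\ge 0$ such that for every $\epsilon>0$ there exists $\delta_0>0$ such that for every $0<\delta\le\delta_0$ there is a cover $\{U_i\}_{i\in I}$ of $F$ with $\delta^{1/\theta}\le |U_i|\le \delta$ for all $i$ and $\sum_{i}|U_i|^s\le\epsilon$. Covers are finite or countable. For $\theta=0$ one reads $\delta^{1/\theta}=0$, i.e. there is no lower restriction on the diameters, and both dimensions equal the Hausdorff dimension. Complementary sets. $\mathcal{C}_a$ is the family of all closed sets $E\subset[0,1]$ of the form $E=[0,1]\setminus\bigcup_{j\ge1}U_j$, where $\{U_j\}$ is a disjoint family of open intervals contained in $[0,1]$ with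 $|U_j|=a_j$ for all $j$. The countable set is $D_a=\{\sum_{i=k}^\infty a_i : k\in\mathbb{N}\}$. *)

(* Defs.v *)
From HB Require Import structures.
From mathcomp Require Import all_boot all_order all_algebra.
From mathcomp Require Import all_classical all_reals all_analysis.

Set Implicit Arguments.
Unset Strict Implicit.
Unset Printing Implicit Defensive.

Import Order.TTheory GRing.Theory Num.Theory.
Import numFieldNormedType.Exports.

Local Open Scope classical_set_scope.
Local Open Scope ring_scope.

Section IntermediateDimensions.
Context {R : realType}.
Implicit Types (F U : set R) (theta delta s eps : R).

(* [0] is adjoined so that the empty set has diameter 0 rather than -oo. *)
Definition diam U : \bar R :=
  ereal_sup (0%E |` [set (`|x - y|)%:E | x in U & y in U]).

(* delta^(1/theta), read as 0 when theta = 0 (where [theta^-1 = 0] would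
   give the value 1 instead). *)
Definition lower_scale theta delta : R :=
  if theta == 0 then 0 else delta `^ theta^-1.

(* The index set [I] is an arbitrary subset of [nat], so that both finite and
   countably infinite covers are allowed. *)
Definition has_theta_cover theta F s eps delta : Prop :=
  exists (I : set nat) (U : nat -> set R),
    [/\ F `<=` \bigcup_(i in I) U i,
        forall i, I i ->
          ((lower_scale theta delta)%:E <= diam (U i) <= delta%:E)%E &
        (\esum_(i in I) poweR (diam (U i)) s <= eps%:E)%E].

Definition lower_intermediate_dim theta F : \bar R :=
  ereal_inf [set s%:E | s in [set s : R | 0 <= s /\
    forall eps delta0, 0 < eps -> 0 < delta0 ->
      exists2 delta : R, 0 < delta <= delta0 & has_theta_cover theta F s eps delta]].

Definition upper_intermediate_dim theta F : \bar R :=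
  ereal_inf [set s%:E | s in [set s : R | 0 <= s /\
    forall eps, 0 < eps -> exists2 delta0 : R, 0 < delta0 &
      forall delta, 0 < delta <= delta0 -> has_theta_cover theta F s eps delta]].

(* Sequences are indexed from 0: [a j] is the usual a_(j+1). *)
Definition complementary_sets (a : R^nat) : set (set R) :=
  [set E | closed E /\
    exists l r : R^nat,
      [/\ forall j, `]l j, r j[%classic `<=` `[0, 1]%classic,
          forall j, diam `]l j, r j[%classic = (a j)%:E,
          trivIset setT (fun j => `]l j, r j[%classic) &
          E = `[0, 1]%classic `\` \bigcup_j `]l j, r j[%classic]].

Definition tail_sums (a : R^nat) : set R :=
  [set \big[+%R/0]_(k <= i <oo) a i | k in @setT nat].

End IntermediateDimensions.

(* Main.v *)
Require Import Defs.
From HB Require Import structures.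
From mathcomp Require Import all_boot all_order all_algebra.
From mathcomp Require Import all_classical all_reals all_analysis.
From mathcomp Require Import lra.

(** Any admissible cover of [E] at scale [delta] is turned into an admissible
    cover of the tail sums [x_k = a_k + a_(k+1) + ...] at the same scale, using
    each of the diameters [d_i] of the given sets at most twice.  The cost then
    at most doubles ([has_theta_cover_tail_sums]), and since the definitions of
    both dimensions quantify over every [eps > 0], the factor 2 is harmless.

    If the cover of [E] is infinite there is nothing geometric to do: the points
    [x_k] are countably many, so each of them can be placed in an interval of
    length some [d_i], one index [i] per point.

    If the cover consists of [n] sets, enclose each in a closed interval of the
    same length [d_i].  Call a gap of [E] covered when one of these intervals
    contains it.  The right end of an uncovered gap belongs to [E], hence to one
    of the intervals, and no interval contains the right ends of two uncovered
    gaps, because it would then contain the whole of the right-hand gap.  So at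
    most [n] gaps are uncovered ([count_uncovered_gaps]).  The covered gaps are
    disjoint and lie in the union of the intervals, so their lengths add up to at
    most the sum of the [d_i] ([covered_gaps_length]).  As [a] is non-increasing,
    dropping at most [n] of its terms leaves at least [x_n]; therefore [x_n] is at
    most the sum of the [d_i].  Consequently one copy of the intervals, laid end
    to end from 0, covers every [x_k] with [k >= n], and a second copy covers
    [x_0, ..., x_(n-1)] one point at a time. *)

Set Implicit Arguments.
Unset Strict Implicit.
Unset Printing Implicit Defensive.

Import Order.TTheory GRing.Theory Num.Theory.
Import numFieldNormedType.Exports.

Local Open Scope classical_set_scope.
Local Open Scope ring_scope.

(** * Diameters of subsets of the line *)

Lemma diam_ge0 (R : realType) (U : set R) : (0 <= diam U)%E.
Proof. by apply: ereal_sup_ubound; left. Qed.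

Lemma diam_ge_dist (R : realType) (U : set R) x y :
  U x -> U y -> (`|x - y|%:E <= diam U)%E.
Proof. by move=> Ux Uy; apply: ereal_sup_ubound; right; exists x => //; exists y. Qed.

Lemma diam_le (R : realType) (U : set R) (d : R) : 0 <= d ->
  (forall x y, U x -> U y -> `|x - y| <= d) -> (diam U <= d%:E)%E.
Proof.
move=> d0 dU; apply: ge_ereal_sup => _ [->|[x Ux [y Uy <-]]]; first by rewrite lee_fin.
by rewrite lee_fin; exact: dU.
Qed.

Lemma diam_itvcc (R : realType) (c d : R) : 0 <= d ->
  diam `[c, c + d]%classic = d%:E.
Proof.
move=> d0; apply/eqP; rewrite eq_le; apply/andP; split.
  apply: diam_le => // x y /=; rewrite !in_itv /= => ? ?.
  by rewrite ler_norml; lra.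
have -> : d%:E = `|(c + d) - c|%:E by rewrite addrAC subrr add0r ger0_norm.
by apply: diam_ge_dist => /=; rewrite in_itv /=; lra.
Qed.

(** Only the bound of the diameter by the length is stated: it is the direction
    needed to compare the sum of the [a j] with Lebesgue measure.  Positivity of
    the diameter excludes the degenerate case where the interval is empty. *)
Lemma diam_itvoo_gt0 (R : realType) (l r e : R) : 0 < e ->
  diam `]l, r[%classic = e%:E -> l < r /\ e <= r - l.
Proof.
move=> e0 de.
have lr : l < r.
  rewrite ltNge; apply/negP => rl.
  suff : (diam `]l, r[%classic <= 0%:E)%E by rewrite de lee_fin; lra.
  by apply: diam_le => // x y /=; rewrite in_itv /=; lra.
split=> //; rewrite -lee_fin -de; apply: diam_le; first lra.
by move=> x y /=; rewrite !in_itv /= => ? ?; rewrite ler_norml; lra.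
Qed.

(** Replaces an arbitrary set by a convex one of the same diameter.  For the empty
    set, [inf] is a default value and the inclusion is vacuous. *)
Lemma sub_itv_diam (R : realType) (U : set R) : diam U \is a fin_num ->
  U `<=` `[inf U, inf U + fine (diam U)]%classic.
Proof.
move=> dfin x Ux; have dist y z : U y -> U z -> `|y - z| <= fine (diam U).
  by move=> Uy Uz; rewrite -lee_fin fineK//; exact: diam_ge_dist.
have lbU y : U y -> lbound U (y - fine (diam U)).
  by move=> Uy z Uz; have := dist _ _ Uy Uz; rewrite ler_norml; lra.
rewrite /= in_itv /=; apply/andP; split.
  by apply: ge_inf => //; exists (x - fine (diam U)); exact: lbU.
by rewrite -lerBlDr; apply: lb_le_inf; [exists x|exact: lbU].
Qed.

(** * Operations on admissible covers *)

(** The two index sets are made disjoint inside [nat] by sending one to the even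
    and the other to the odd numbers. *)
Lemma has_theta_coverU (R : realType) (theta s delta e1 e2 : R) (F G : set R) :
  has_theta_cover theta F s e1 delta -> has_theta_cover theta G s e2 delta ->
  has_theta_cover theta (F `|` G) s (e1 + e2) delta.
Proof.
move=> [I [U [FU dU sU]]] [J [V [GV dV sV]]].
pose W n := if odd n then V n./2 else U n./2.
pose oddn i := (i.*2.+1)%N.
have WU i : W i.*2 = U i by rewrite /W odd_double doubleK.
have WV i : W (oddn i) = V i by rewrite /W /= odd_double /= uphalf_double.
exists ((double @` I) `|` (oddn @` J)), W; split.
- move=> x [/FU[i Ii Ux]|/GV[i Ji Vx]].
    by exists i.*2; [left; exists i|rewrite WU].
  by exists (oddn i); [right; exists i|rewrite WV].
- by move=> _ [[i Ii <-]|[i Ji <-]]; rewrite ?WU ?WV; [exact: dU|exact: dV].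
rewrite (@esumID _ _ (double @` I)); last by move=> i _; exact: poweR_ge0.
have -> : ((double @` I) `|` (oddn @` J)) `&` (double @` I) = double @` I.
  by rewrite setIC; apply/setIidl; left.
have -> : ((double @` I) `|` (oddn @` J)) `&` ~` (double @` I) = oddn @` J.
  apply/seteqP; split=> [x [[//|//]]|_ [i Ji <-]].
  split; first by right; exists i.
  by move=> [j _ /(congr1 odd)]; rewrite /oddn /= !odd_double.
rewrite EFinD; apply: leeD.
  rewrite (@reindex_esum _ _ _ I _ double); last first.
    by apply: inj_bij => x y _ _ /double_inj.
  by apply: le_trans sU; apply: le_esum => i _; rewrite WU.
rewrite (@reindex_esum _ _ _ J _ oddn); last first.
  by apply: inj_bij => x y _ _ [] /double_inj.
by apply: le_trans sV; apply: le_esum => i _; rewrite WV.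
Qed.

(** Admissibility and cost depend on the diameters alone, so the sets of a cover
    may be replaced by intervals of the same diameters, placed anywhere. *)
Lemma has_theta_cover_translates (R : realType) (theta s delta eps : R)
    (G : set R) (I : set nat) (U : nat -> set R) (c : nat -> R) :
  (forall i, I i -> ((lower_scale theta delta)%:E <= diam (U i) <= delta%:E)%E) ->
  (\esum_(i in I) poweR (diam (U i)) s <= eps%:E)%E ->
  (forall x, G x -> exists2 i, I i & c i <= x <= c i + fine (diam (U i))) ->
  has_theta_cover theta G s eps delta.
Proof.
move=> dU sU cU; pose V i := `[c i, c i + fine (diam (U i))]%classic.
have dV i : I i -> diam (V i) = diam (U i).
  move=> Ii; rewrite diam_itvcc ?fine_ge0 ?diam_ge0// fineK//.
  rewrite ge0_fin_numE ?diam_ge0//; case/andP: (dU _ Ii) => _ /le_lt_trans.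
  by apply; exact: ltry.
exists I, V; split.
- by move=> x /cU[i Ii cx]; exists i => //; rewrite /V /= in_itv.
- by move=> i Ii; rewrite dV//; exact: dU.
- by apply: le_trans sU; apply: le_esum => i Ii; rewrite dV.
Qed.

(** * Two facts about finite sums *)

(** By induction on [N]: when [P N] holds, the new term [a N] on the left is
    matched on the right by a term whose index is the number of earlier elements
    of [P], which is at most [N]. *)
Lemma sum_pred_le_initial (R : numDomainType) (a : R^nat) (P : pred nat) N :
  nonincreasing_seq a ->
  \sum_(0 <= j < N | P j) a j <= \sum_(0 <= j < count P (iota 0 N)) a j.
Proof.
move=> adec; elim: N => [|N IH]; first by rewrite !big_geq.
rewrite -addn1 iotaD count_cat /= add0n addn0 addn1 big_mkcond big_nat_recr//=.
rewrite -big_mkcond /=; case: (P N); last by rewrite addn0 addr0.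
rewrite addn1 big_nat_recr//= lerD// adec//.
by rewrite -[leqRHS](size_iota 0); exact: count_size.
Qed.

(** The interval of index [i] starts where the lengths of its predecessors in [s]
    end, so the intervals tile the segment from 0 to the total length.  The point
    0 is left out because [s] may be empty. *)
Lemma consecutive_intervals_cover (R : realDomainType) (d : nat -> R) (s : seq nat) x :
  uniq s -> 0 < x <= \sum_(i <- s) d i ->
  exists2 i, i \in s & \sum_(j <- take (index i s) s) d j <= x
    <= \sum_(j <- take (index i s) s) d j + d i.
Proof.
elim/last_ind: s => [_|s z IH]; first by rewrite big_nil; lra.
rewrite rcons_uniq => /andP[zs us]; rewrite -cats1 big_cat big_seq1 /= => hx.
have [xs|sx] := leP x (\sum_(i <- s) d i).
  have [|i si hi] := IH us; first by lra.
  exists i; first by rewrite mem_cat si.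
  by rewrite index_cat si take_cat index_mem si.
exists z; first by rewrite mem_cat inE eqxx orbT.
rewrite index_cat (negbTE zs) /= eqxx addn0 take_size_cat//; lra.
Qed.

(** * Gaps of a complementary set and covers by intervals *)

Section Gaps.
Variables (R : realType) (a l r : R^nat).
Hypothesis a_gt0 : forall n, 0 < a n.
Hypothesis gap01 : forall j, `]l j, r j[%classic `<=` `[0, 1]%classic.
Hypothesis diam_gap : forall j, diam `]l j, r j[%classic = (a j)%:E.
Hypothesis gap_triv : trivIset setT (fun j => `]l j, r j[%classic).

Let gap_lt j : l j < r j.
Proof. by case: (diam_itvoo_gt0 (a_gt0 j) (diam_gap j)). Qed.

Lemma gaps_separated j k : r j <= r k -> j != k -> r j <= l k.
Proof.
move=> rjk jk; rewrite leNgt; apply/negP => lkrj.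
have ljrj := gap_lt j; pose m := Num.max (l j) (l k).
have [lm km mr] : [/\ l j <= m, l k <= m & m < r j].
  by rewrite /m !le_max !lexx orbT gt_max ljrj lkrj.
apply: (negP jk); apply/eqP; apply: gap_triv => //.
by exists ((m + r j) / 2); split; rewrite /= in_itv /=; lra.
Qed.

(** A gap reaching past 1, or an open gap around the right end of another one,
    would contain a point just to the left of [r j] that it must avoid; below,
    such a point is the midpoint between [r j] and the largest of the obstacles
    to its left. *)
Lemma gap_right_end_in_compl j :
  (`[0, 1]%classic `\` \bigcup_k `]l k, r k[%classic) (r j).
Proof.
have lr := gap_lt j; split=> [|[k _]]; rewrite /= in_itv /=.
  (* the midpoint of the gap lies in [0, 1], which gives 0 <= r j *)
  have [|x0 _] := andP (_ : 0 <= (l j + r j) / 2 <= 1).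
    by have /(_ ((l j + r j) / 2)) := @gap01 j; rewrite /= !in_itv /=; apply; lra.
  apply/andP; split; first by lra.
  rewrite leNgt; apply/negP => r1.
  pose m := Num.max (l j) 1.
  have [lm m1 mr] : [/\ l j <= m, 1 <= m & m < r j].
    by rewrite /m !le_max !lexx orbT gt_max lr r1.
  have /(_ ((m + r j) / 2)) := @gap01 j; rewrite /= !in_itv /= => H.
  by have := H _; lra.
move=> /andP[lk rk]; have [jk|jk] := eqVneq j k; first by subst; lra.
by have := gaps_separated (ltW rk) jk; lra.
Qed.

Variables (c d : nat -> R) (s : seq nat).
Hypothesis d_ge0 : forall i, 0 <= d i.
Hypothesis cover : forall x, (`[0, 1]%classic `\` \bigcup_k `]l k, r k[%classic) x ->
  exists2 i, i \in s & c i <= x <= c i + d i.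

Let covered j := `[< exists2 i, i \in s & c i <= l j /\ r j <= c i + d i >].

(** Sending an uncovered gap to an interval that contains its right end is
    injective: of two gaps sent to the same interval, the one further right would
    lie between the two right ends, inside that interval. *)
Lemma count_uncovered_gaps N : (count (predC covered) (iota 0 N) <= size s)%N.
Proof.
have /choice[f fP] j : exists i, i \in s /\ c i <= r j <= c i + d i.
  by have [i si hi] := cover (gap_right_end_in_compl j); exists i.
rewrite -size_filter -(size_map f); apply: uniq_leq_size; last first.
  by move=> _ /mapP[j _ ->]; case: (fP j).
rewrite map_inj_in_uniq ?filter_uniq ?iota_uniq// => j k.
rewrite !mem_filter => /andP[/= /asboolPn uj _] /andP[/= /asboolPn uk _] fjk.
have [fj hj] := fP j; have [fk hk] := fP k; rewrite -fjk in hk.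
have [//|jk] := eqVneq j k; exfalso.
have [rjk|/ltW rkj] := leP (r j) (r k).
  by apply: uk; exists (f j) => //; have := gaps_separated rjk jk; lra.
by apply: uj; exists (f j) => //; rewrite eq_sym in jk; have := gaps_separated rkj jk; lra.
Qed.

(** Lebesgue measure of the disjoint union of the covered gaps, against
    subadditivity for the intervals of the cover. *)
Lemma covered_gaps_length N :
  \sum_(0 <= j < N | covered j) a j <= \sum_(i <- s) d i.
Proof.
pose mu := @lebesgue_measure R.
pose G j := if covered j then `]l j, r j[%classic else set0.
have mG j : measurable (G j) by rewrite /G; case: ifP.
have tG : trivIset setT G.
  move=> i j _ _; rewrite /G; case: ifP => _; last by rewrite set0I => -[].
  by case: ifP => _; [exact: gap_triv | rewrite setI0 => -[]].
pose H k := `[c (nth 0%N s k), c (nth 0%N s k) + d (nth 0%N s k)]%classic.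
have GH : \big[setU/set0]_(j < N) G j `<=` \big[setU/set0]_(k < size s) H k.
  rewrite -!bigcup_mkord => x [j _]; rewrite /G.
  case: ifP => // /asboolP[i si hi] /=; rewrite in_itv /= => hx.
  exists (index i s); first by rewrite /= index_mem.
  by rewrite /H /= nth_index// in_itv /=; lra.
have mH k : mu (H k) = (d (nth 0%N s k))%:E.
  rewrite /mu /H lebesgue_measure_itv /= lte_fin; case: ifPn => h.
    by rewrite -EFinB; congr EFin; lra.
  by congr EFin; have := d_ge0 (nth 0%N s k); lra.
have muG j : ((if covered j then a j else 0)%:E <= mu (G j))%E.
  rewrite /G; case: ifP => _; last by rewrite /mu measure0.
  rewrite /mu lebesgue_measure_itv /= lte_fin gap_lt -EFinB lee_fin.
  by case: (diam_itvoo_gt0 (a_gt0 j) (diam_gap j)).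
rewrite -lee_fin big_mkcond /= big_mkord -sumEFin.
apply: (@le_trans _ _ (\sum_(j < N) mu (G j))%E); first exact: lee_sum.
rewrite -measure_bigsetU//.
apply: (le_trans (@content_subadditive _ _ _ mu _ H (size s) _ _ GH)).
- by move=> k _; rewrite /H; exact: measurable_itv.
- by apply: bigsetU_measurable => j _; exact: mG.
- by rewrite (big_nth 0%N) big_mkord -sumEFin; apply: lee_sum => k _; rewrite -mH.
Qed.

(** The covered gaps account for at most the total length of the cover, and the
    uncovered ones, being at most [size s] in number, for at most the sum of the
    [size s] largest terms of [a]. *)
Lemma partial_sum_le_cover_length N : nonincreasing_seq a ->
  \sum_(0 <= j < N) a j <= \sum_(0 <= j < size s) a j + \sum_(i <- s) d i.
Proof.
move=> adec; rewrite (bigID (predC covered)) /= lerD//; last first.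
  rewrite (eq_bigl covered) ?covered_gaps_length// => j; exact: negbK.
apply: (le_trans (sum_pred_le_initial (predC covered) N adec)).
rewrite (big_cat_nat (leq0n _) (count_uncovered_gaps N)) /= lerDl.
by apply: sumr_ge0 => i _; exact: ltW.
Qed.

End Gaps.

(** * Covering the tail sums *)

Lemma tail_sum_gt0 (R : realType) (a : R^nat) k : (forall n, 0 < a n) ->
  cvgn (series a) -> 0 < \big[+%R/0]_(k <= i <oo) a i.
Proof.
move=> a_gt0 ca; have nd : {homo (fun n => \sum_(k <= i < n) a i) : n m / (n <= m)%N >-> n <= m}.
  move=> n m nm; have [kn|nk] := leqP k n.
    rewrite (big_cat_nat kn nm) /= lerDl.
    by apply: sumr_ge0 => i _; exact: ltW.
  by rewrite big_geq ?(ltnW nk)//; apply: sumr_ge0 => i _; exact: ltW.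
apply: (@lt_le_trans _ _ (\sum_(k <= i < k.+1) a i)); first by rewrite big_nat1.
by apply: (nondecreasing_cvgn_le nd); rewrite is_cvg_series_restrict.
Qed.

(** The conclusion carries [eps + eps] because every set of the cover of [E] is
    used twice when the cover is finite: once for a single large tail sum, and
    once in the row of consecutive intervals that holds the small ones. *)
Lemma has_theta_cover_tail_sums (R : realType) (a : R^nat) (E : set R)
    (theta s eps delta : R) :
  (forall n, 0 < a n) -> nonincreasing_seq a -> cvgn (series a) ->
  complementary_sets a E ->
  has_theta_cover theta E s eps delta ->
  has_theta_cover theta (tail_sums a) s (eps + eps) delta.
Proof.
move=> a_gt0 adec ca [_ [l [r [gap01 dgap tgap EE]]]] [I [U [EU dU sU]]].
pose x k := \big[+%R/0]_(k <= i <oo) a i.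
(* One set of the cover per tail sum: [f] tells which tail sum the set of
   index [i] is responsible for. *)
have points (f : nat -> nat) (A : set nat) : (forall k, A k -> exists2 i, I i & f i = k) ->
    has_theta_cover theta (x @` A) s eps delta.
  move=> fA; apply: (has_theta_cover_translates (c := fun i => x (f i)) dU sU).
  move=> _ [k /fA[i Ii <-] <-]; exists i => //.
  by rewrite lexx lerDl fine_ge0// diam_ge0.
have [finI|] := pselect (finite_set I); last first.
  (* An infinite [I] maps onto [nat], so one set per tail sum suffices; that
     cover is taken twice only to match the cost [eps + eps]. *)
  move=> /infiniteP/pcard_surjP[f fsurj].
  rewrite -[tail_sums a]setUid; apply: has_theta_coverU;
    by apply: (points f setT) => k _; have [i Ii <-] := fsurj k Logic.I; exists i.
have [s0 Is0] := (finite_seqP I).1 finI.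
pose t := undup s0; have ut : uniq t := undup_uniq s0.
have tI i : i \in t <-> I i by rewrite Is0 /t mem_undup.
pose d i := fine (diam (U i)).
have d_ge0 i : 0 <= d i by rewrite fine_ge0// diam_ge0.
have x_le k : (size t <= k)%N -> x k <= \sum_(i <- t) d i.
  move=> tk; apply: limr_le; first by rewrite is_cvg_series_restrict.
  exists k => // N /= kN.
  have := @partial_sum_le_cover_length _ a l r a_gt0 gap01 dgap tgap
    (fun i => inf (U i)) d t d_ge0 _ N adec.
  rewrite (big_cat_nat (leq0n _) (leq_trans tk kN)) /= lerD2l.
  rewrite (big_cat_nat tk kN) /= => H.
  apply: le_trans (H _); first by rewrite lerDr; apply: sumr_ge0 => i _; exact: ltW.
  move=> y y_compl; have /EU[i Ii Uy] : E y by rewrite EE.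
  exists i; first exact/tI.
  have fin : diam (U i) \is a fin_num.
    rewrite ge0_fin_numE ?diam_ge0//; case/andP: (dU _ Ii) => _ /le_lt_trans.
    by apply; exact: ltry.
  by have := sub_itv_diam fin Uy; rewrite /= in_itv.
have -> : tail_sums a = (x @` `I_(size t)) `|` (x @` [set k | (size t <= k)%N]).
  rewrite -image_setU; congr image; apply/seteqP; split=> // k _.
  by case: (ltnP k (size t)) => ?; [left|right].
apply: has_theta_coverU.
  apply: (points (index^~ t)) => k /= kt; exists (nth 0%N t k).
    by apply/tI; rewrite mem_nth.
  by rewrite index_uniq.
apply: (has_theta_cover_translates
  (c := fun i => \sum_(j <- take (index i t) t) d j) dU sU) => _ [k /= tk <-].
have [|i /tI Ii hi] := @consecutive_intervals_cover R d t (x k) ut; last by exists i.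
by rewrite tail_sum_gt0//= x_le.
Qed.

Theorem lemma5p2 (R : realType) (a : R^nat) (E : set R) (theta : R)
    (a_gt0 : forall n, 0 < a n)
    (a_nonincr : nonincreasing_seq a)
    (a_sum1 : series a @ \oo --> (1 : R))
    (hE : complementary_sets a E)
    (htheta : 0 <= theta <= 1) :
  (upper_intermediate_dim theta (tail_sums a)
     <= upper_intermediate_dim theta E)%E /\
  (lower_intermediate_dim theta (tail_sums a)
     <= lower_intermediate_dim theta E)%E.
Proof.
have ca : cvgn (series a) by apply/cvg_ex; exists 1.
have transfer s eps delta : has_theta_cover theta E s (eps / 2) delta ->
    has_theta_cover theta (tail_sums a) s eps delta.
  by rewrite {2}[eps]splitr; exact: has_theta_cover_tail_sums.
split; apply: le_ereal_inf => _ [s [s0 hs] <-]; exists s => //; split=> //.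
  move=> eps e0; have [|delta0 d0 hd] := hs (eps / 2); first by rewrite divr_gt0.
  by exists delta0 => // delta /hd; exact: transfer.
move=> eps delta0 e0 d0; have [||delta hd hc] := hs (eps / 2) delta0 => //.
  by rewrite divr_gt0.
by exists delta => //; exact: transfer.
Qed.
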